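(* Let $(\mathcal{M},d_{\mathcal{M}})$ be a metric space, $r_1,\ldots,r_\ell\in\mathcal{M}$, and for real $p\ge 1$ let $F_r^p:\mathcal{M}\to\mathbb{R}_+^\ell$ be given by $F_r^p(x)=(d_{\mathcal{M}}(r_1,x)^p,\ldots,d_{\mathcal{M}}(r_\ell,x)^p)$. Then $F_r^1$ is globally Lipschitz on $\mathcal{M}$. Moreover, if for some $x_0\in\mathcal{M}$ and $\delta>0$ one has $r_1,\ldots,r_\ell\in B(x_0,\delta)$, then for any $p\ge 1$ and any $x,x'\in B(x_0,\delta)$, $$\|F_r^p(x)-F_r^p(x')\|_\infty\le p\,2^{p-1}\,\delta^{p-1}\,d_{\mathcal{M}}(x,x').$$
   Context: $B(x_0,\delta)$ is the ball of center $x_0$ and radius $\delta$ in $\mathcal{M}$; $\|\cdot\|_\infty$ is the sup norm on $\mathbb{R}^\ell$. *)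

(* Defs.v *)
From HB Require Import structures.
From mathcomp Require Import all_boot all_order all_algebra.
From mathcomp Require Import all_classical all_reals all_analysis.

Set Implicit Arguments.
Unset Strict Implicit.
Unset Printing Implicit Defensive.

Import Order.TTheory GRing.Theory Num.Theory.
Import numFieldNormedType.Exports.

Local Open Scope classical_set_scope.
Local Open Scope ring_scope.

(* The library norm on ['rV[R]_l] is the sup norm, see [mx_normrE]; the values
   lie in the nonnegative orthant by [dist_map_ge0]. *)
Definition dist_map (R : realType) (M : metricType R) (l : nat)
    (r : 'I_l -> M) (p : R) (x : M) : 'rV[R]_l :=
  \row_(i < l) (mdist (r i) x `^ p).

Lemma dist_map_ge0 (R : realType) (M : metricType R) (l : nat)
    (r : 'I_l -> M) (p : R) (x : M) (i : 'I_l) :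
  0 <= dist_map r p x 0 i.
Proof. by rewrite mxE powR_ge0. Qed.

(* The library's [lipschitz] requires a normed module as the domain. *)
Definition globally_lipschitz (R : realType) (M : metricType R)
    (V : normedModType R) (f : M -> V) : Prop :=
  exists2 L : R, 0 <= L & forall x x' : M, `|f x - f x'| <= L * mdist x x'.

(* Main.v *)
Require Import Defs.
From HB Require Import structures.
From mathcomp Require Import all_boot all_order all_algebra.
From mathcomp Require Import all_classical all_reals all_analysis.
From mathcomp Require Import ring lra.

Import Order.TTheory GRing.Theory Num.Theory.
Import numFieldNormedType.Exports.

Local Open Scope classical_set_scope.
Local Open Scope ring_scope.

(** By the reverse triangle inequality [mdist_lipschitz], each distance to [r i] is 1-Lipschitz;
    this settles exponent 1 with constant 1. Inside the ball these distances lie in [0, 2 delta],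
    where t^p has Lipschitz constant p (2 delta)^(p-1) by [powR_lipschitz], a consequence of
    convexity. Composing bounds every coordinate, hence the sup norm. *)

(* Young's inequality for [b] and [a `^ (p - 1)], with exponents [p] and
   [p / (p - 1)]. *)
Lemma powR_above_tangent (R : realType) (a b p : R) :
  0 <= a -> 0 <= b -> 1 <= p ->
  a `^ p - b `^ p <= p * a `^ (p - 1) * (a - b).
Proof.
(* The case p = 1 is separate: its conjugate exponent would be infinite. *)
move=> a0 b0; rewrite le_eqVlt => /predU1P[<-|p1].
  by rewrite subrr powRr0 !powRr1// !mul1r.
have p0 : 0 < p by lra.
have q0 : 0 < p - 1 by lra.
have hol : p^-1 + (p / (p - 1))^-1 = 1 by field; rewrite !gt_eqF.
have := conjugate_powR b0 (powR_ge0 a (p - 1)) p0 (divr_gt0 p0 q0) hol.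
rewrite -powRrM mulrCA divff ?gt_eqF// mulr1 -(ler_pM2l p0).
have -> : p * (b `^ p / p + a `^ p / (p / (p - 1))) =
    b `^ p + (p - 1) * a `^ p by field; rewrite !gt_eqF.
(* Young's inequality times p now reads p b a^(p-1) <= b^p + (p-1) a^p; since a a^(p-1) = a^p, this
   rearranges to the goal. *)
have := mulr_powRB1 a0 p0.
by nra.
Qed.

(** The tangent at the larger of the two points has slope at most p C^(p-1), because t^(p-1) is
    nondecreasing. *)
Lemma powR_lipschitz (R : realType) (a b C p : R) :
  0 <= a <= C -> 0 <= b <= C -> 1 <= p ->
  `|a `^ p - b `^ p| <= p * C `^ (p - 1) * `|a - b|.
Proof.
move=> + + p1; wlog ba : a b / b <= a => [wlg|] aC bC.
  have /orP[ba|ab] := le_total b a; first exact: wlg.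
  by rewrite distrC (distrC a); exact: wlg.
have [[/andP[a0 aC'] /andP[b0 _]] p0] := ((aC, bC), lt_le_trans ltr01 p1).
have ab0 : 0 <= a - b by rewrite subr_ge0.
rewrite !ger0_norm//; last by rewrite subr_ge0 ge0_ler_powR// ltW.
apply: le_trans (powR_above_tangent _ _ _ _ a0 b0 p1) _.
rewrite ler_wpM2r// ler_wpM2l ?(ltW p0)//.
by rewrite ge0_ler_powR ?subr_ge0// nnegrE// (le_trans a0).
Qed.

Lemma mdist_lipschitz (R : realType) (M : metricType R) (z x x' : M) :
  `|mdist z x - mdist z x'| <= mdist x x'.
Proof.
rewrite ler_norml lerBlDr lerNl opprB lerBlDr.
by rewrite addrC metric_triangle (metric_sym x x') addrC metric_triangle.
Qed.

(** The norm is a maximum of absolute values started at 0, so [0 <= e] covers the empty row. *)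
Lemma row_norm_le (R : realType) (l : nat) (v : 'rV[R]_l) (e : R) :
  0 <= e -> (forall i, `|v 0 i| <= e) -> `|v| <= e.
Proof.
move=> e0 ve; rewrite /Num.Def.normr/= mx_normrE bigmax_le// => -[i j] _.
by rewrite ord1 ve.
Qed.

Lemma ball_mdist_lt (R : realType) (M : metricType R) (x0 x y : M) (d : R) :
  ball x0 d x -> ball x0 d y -> mdist x y < 2 * d.
Proof.
rewrite !ballEmdist/= metric_sym => xd yd.
by rewrite (le_lt_trans (metric_triangle x x0 y))// mulr_natl mulr2n ltrD.
Qed.

Theorem proposition1 (R : realType) (M : metricType R) (l : nat)
    (r : 'I_l -> M) :
  globally_lipschitz (dist_map r 1) /\
  (forall (x0 : M) (delta : R), 0 < delta ->
    (forall i : 'I_l, ball x0 delta (r i)) ->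
    forall p : R, 1 <= p ->
    forall x x' : M, ball x0 delta x -> ball x0 delta x' ->
      `|dist_map r p x - dist_map r p x'|
        <= p * 2 `^ (p - 1) * delta `^ (p - 1) * mdist x x').
Proof.
split.
  exists 1 => // x x'; rewrite mul1r; apply: row_norm_le => [|i].
    exact: mdist_ge0.
  by rewrite !mxE !powRr1 ?mdist_ge0// mdist_lipschitz.
move=> x0 d d0 rd p p1 x x' xd x'd.
rewrite -(mulrA p) -powRM ?(ltW d0)//.
have c0 : 0 <= p * (2 * d) `^ (p - 1).
  by rewrite mulr_ge0 ?powR_ge0// (le_trans ler01).
apply: row_norm_le => [|i]; first by rewrite mulr_ge0 ?mdist_ge0.
rewrite !mxE.
(* Take C = 2 delta: [r i], [x] and [x'] all lie in a ball of diameter at most 2 delta. *)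
apply: (le_trans (powR_lipschitz _ _ _ (2 * d) _ _ _ p1)).
- by rewrite mdist_ge0 ltW// (ball_mdist_lt _ _ x0).
- by rewrite mdist_ge0 ltW// (ball_mdist_lt _ _ x0).
- by rewrite ler_wpM2l// mdist_lipschitz.
Qed.
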